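(* Let $\mathbf{D}$ be a generalized divergence and $\mathbf{R}$ the associated generalized Rains information of bipartite channels. Let $\mathcal{M}_{\hat A'\hat B'\to\hat A\hat B}$ be a bipartite quantum channel and $\Theta^{\mathrm{PPT}}$ a completely-PPT-preserving superchannel, $\Theta^{\mathrm{PPT}}(\mathcal{M})=\mathcal{P}^{\mathrm{post}}_{A_M\hat A\hat BB_M\to AB}\circ\mathcal{M}\circ\mathcal{P}^{\mathrm{pre}}_{A'B'\to\hat A'\hat B'A_MB_M}$ with $\mathcal{P}^{\mathrm{pre}},\mathcal{P}^{\mathrm{post}}$ completely PPT-preserving. Then $$\mathbf{R}(\mathcal{M})\ge\mathbf{R}(\Theta^{\mathrm{PPT}}(\mathcal{M})).$$
   Context: A generalized divergence $\mathbf{D}(\rho\|\sigma)$ (for a state $\rho$ and positive semidefinite $\sigma$) is any function satisfying data processing $\mathbf{D}(\rho\|\sigma)\ge\mathbf{D}(\mathcal{E}(\rho)\|\mathcal{E}(\sigma))$ for all quantum channels $\mathcal{E}$. The generalized channel divergence of a channel $\mathcal{N}_{C\to D}$ and a completely positive map $\mathcal{M}_{C\to D}$ is $\mathbf{D}(\mathcal{N}\|\mathcal{M})=\sup_{\psi_{RC}}\mathbf{D}(\mathcal{N}(\psi_{RC})\|\mathcal{M}(\psi_{RC}))$ over pure states with $R\simeq C$. For a bipartite map $\mathcal{M}_{A'B'\to AB}$ (Alice: $A',A$; Bob: $B',B$), $E_N(\mathcal{M})=\log\|T_B\circ\mathcal{M}\circ T_{B'}\|_\diamond$, $T_X$ the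 partial transpose. The generalized Rains information of a bipartite channel $\mathcal{N}$ is $\mathbf{R}(\mathcal{N})=\inf_{\mathcal{M}:E_N(\mathcal{M})\le 0}\mathbf{D}(\mathcal{N}\|\mathcal{M})$, infimum over completely positive bipartite maps $\mathcal{M}_{A'B'\to AB}$. A bipartite channel is completely PPT-preserving if conjugating it with partial transposes on Bob's input and output systems yields a completely positive map. In the superchannel, Alice holds $A',\hat A',A_M,\hat A,A$; Bob holds $B',\hat B',B_M,\hat B,B$. *)

(* Defs.v *)
From HB Require Import structures.
From mathcomp Require Import all_boot all_order all_algebra.
From Stdlib Require Import Rdefinitions Raxioms ClassicalEpsilon.

Set Implicit Arguments.
Unset Strict Implicit.
Unset Printing Implicit Defensive.

Import Order.TTheory GRing.Theory Num.Theory.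

Inductive xreal := XFin (r : Rdefinitions.R) | XPInf | XMInf.

Definition xle (x y : xreal) : Prop :=
  match x, y with
  | XMInf, _ => True
  | _, XPInf => True
  | XFin a, XFin b => Rdefinitions.Rle a b
  | _, _ => False
  end.

Definition is_xlub (P : xreal -> Prop) (s : xreal) : Prop :=
  (forall x, P x -> xle x s) /\ (forall u, (forall x, P x -> xle x u) -> xle s u).
Definition is_xglb (P : xreal -> Prop) (s : xreal) : Prop :=
  (forall x, P x -> xle s x) /\ (forall u, (forall x, P x -> xle u x) -> xle u s).

(* supremum / infimum in the complete lattice [-oo,+oo] (sup of empty = -oo,
   inf of empty = +oo); chosen by Hilbert's epsilon. *)
Definition xsup (P : xreal -> Prop) : xreal := epsilon (inhabits XMInf) (is_xlub P).
Definition xinf (P : xreal -> Prop) : xreal := epsilon (inhabits XPInf) (is_xglb P).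

Local Open Scope ring_scope.

Section Quantum.
Variable C : numClosedFieldType.

(* Operators on the Hilbert space C^I, I a finite basis set. Composite
   systems are products of basis sets. *)
Definition Op (I : finType) := I -> I -> C.
Definition LMap (I J : finType) := Op I -> Op J.

Definition mtr (I : finType) (X : Op I) : C := \sum_i X i i.
Definition mmul (I : finType) (X Y : Op I) : Op I := fun i k => \sum_j X i j * Y j k.
Definition madj (I : finType) (X : Op I) : Op I := fun i j => (X j i)^*.

Definition psd (I : finType) (X : Op I) : Prop :=
  forall v : I -> C, 0 <= \sum_i \sum_j (v i)^* * X i j * v j.

Definition is_state (I : finType) (X : Op I) : Prop := psd X /\ mtr X = 1.

Definition is_pure (I : finType) (X : Op I) : Prop :=
  exists v : I -> C, \sum_i `|v i| ^+ 2 = 1 /\ X = fun i j => v i * (v j)^*.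

Definition is_linear_map (I J : finType) (F : LMap I J) : Prop :=
  forall (a : C) (X Y : Op I),
    F (fun i j => a * X i j + Y i j) = fun i j => a * F X i j + F Y i j.

(* id_R (x) F, acting blockwise (this is the tensor extension for linear F) *)
Definition ext (R I J : finType) (F : LMap I J) : LMap (R * I)%type (R * J)%type :=
  fun X p q => F (fun i i' => X (p.1, i) (q.1, i')) p.2 q.2.

Definition is_CP (I J : finType) (F : LMap I J) : Prop :=
  is_linear_map F /\ forall (R : finType) (X : Op (R * I)%type), psd X -> psd (ext F X).

Definition is_TP (I J : finType) (F : LMap I J) : Prop :=
  forall X : Op I, mtr (F X) = mtr X.

Definition is_channel (I J : finType) (F : LMap I J) : Prop := is_CP F /\ is_TP F.

Definition ptB (Al Bo : finType) (X : Op (Al * Bo)%type) : Op (Al * Bo)%type :=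
  fun p q => X (p.1, q.2) (q.1, p.2).

(* ||X||_1 <= c, where ||X||_1 = Tr sqrt(X^dagger X) and sqrt is the
   (unique) positive semidefinite square root *)
Definition tnorm_le (I : finType) (X : Op I) (c : C) : Prop :=
  exists Q : Op I, psd Q /\ mmul Q Q = mmul (madj X) X /\ mtr Q <= c.

(* ||F||_diamond <= c : sup over X on R C (R ~ C) with ||X||_1 <= 1 of
   ||(id_R (x) F)(X)||_1 is at most c *)
Definition diamond_le (I J : finType) (F : LMap I J) (c : C) : Prop :=
  forall X : Op (I * I)%type, tnorm_le X 1 -> tnorm_le (@ext I I J F X) c.

(* E_N(M) <= 0, i.e. log ||T_B o M o T_B'||_diamond <= 0 *)
Definition EN_le0 (A' B' A B : finType) (M : LMap (A' * B')%type (A * B)%type) : Prop :=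
  diamond_le (fun X => ptB (M (ptB X))) 1.

Definition is_cPPT (A' B' A B : finType) (P : LMap (A' * B')%type (A * B)%type) : Prop :=
  is_channel P /\ is_CP (fun X => ptB (P (ptB X))).

Definition is_gen_divergence (D : forall I : finType, Op I -> Op I -> xreal) : Prop :=
  forall (I J : finType) (E : LMap I J), is_channel E ->
    forall rho sigma : Op I, is_state rho -> psd sigma ->
      xle (D J (E rho) (E sigma)) (D I rho sigma).

Definition chan_div (D : forall I : finType, Op I -> Op I -> xreal)
    (I J : finType) (N M : LMap I J) : xreal :=
  xsup (fun x => exists psi : Op (I * I)%type, is_pure psi /\
                   x = D (I * J)%type (@ext I I J N psi) (@ext I I J M psi)).

Definition rains (D : forall I : finType, Op I -> Op I -> xreal)
    (A' B' A B : finType) (N : LMap (A' * B')%type (A * B)%type) : xreal :=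
  xinf (fun x => exists M : LMap (A' * B')%type (A * B)%type,
                   is_CP M /\ EN_le0 M /\ x = chan_div D N M).

(* M (x) id_{A_M B_M}, with systems grouped as (Alice)*(Bob) *)
Definition lift_mem (Ah' Bh' Ah Bh AM BM : finType) (M : LMap (Ah' * Bh')%type (Ah * Bh)%type)
    : LMap ((Ah' * AM) * (Bh' * BM))%type ((Ah * AM) * (Bh * BM))%type :=
  fun X p q =>
    M (fun u w => X ((u.1, p.1.2), (u.2, p.2.2)) ((w.1, q.1.2), (w.2, q.2.2)))
      (p.1.1, p.2.1) (q.1.1, q.2.1).

Definition superchan (A' B' Ah' Bh' AM BM Ah Bh A B : finType)
    (Ppre : LMap (A' * B')%type ((Ah' * AM) * (Bh' * BM))%type)
    (Ppost : LMap ((Ah * AM) * (Bh * BM))%type (A * B)%type)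
    (M : LMap (Ah' * Bh')%type (Ah * Bh)%type) : LMap (A' * B')%type (A * B)%type :=
  fun X => Ppost (@lift_mem Ah' Bh' Ah Bh AM BM M (Ppre X)).

End Quantum.

(* Main.v *)
Require Import Defs.
From mathcomp Require Import all_boot all_order all_algebra.
From mathcomp Require Import ring.
From Stdlib Require Import FunctionalExtensionality Classical ClassicalEpsilon.
From Stdlib Require Rdefinitions Raxioms RIneq.

(** Every completely positive M' admissible for R(M) yields the map Theta(M'),
which is admissible for R(Theta(M)) and satisfies
D(Theta(M) || Theta(M')) <= D(M || M').

The partial transposes of Ppre and Ppost are channels, and
T Theta(M') T = (T Ppost T) o (T M' T (x) id) o (T Ppre T).  A channel contracts
the trace norm, and the diamond norm bound of T M' T, which concerns only a
reference system isomorphic to the input, extends to every reference system.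
Both facts follow from a characterization without singular values: |X|_1 <= c
iff X = L M^* for some L, M with (|L|_2^2 + |M|_2^2) / 2 <= c.

For the divergence, Ppre maps a pure input to a state of reference, memory and
hatted systems, which is (G (x) id)(phi) for a channel G and a pure phi on two
copies of the hatted systems.  As G acts on the reference of phi, it commutes
with M and M', and data processing applies to Ppost o (G (x) id). *)

Set Implicit Arguments.
Unset Strict Implicit.
Unset Printing Implicit Defensive.

Import Order.TTheory GRing.Theory Num.Theory.
Local Open Scope ring_scope.
Local Open Scope sesquilinear_scope.

(** * Matrices *)

Section Matrices.
Variable C : numClosedFieldType.

Lemma adjmxM m n p (A : 'M[C]_(m, n)) (B : 'M[C]_(n, p)) :
  (A *m B)^t* = B^t* *m A^t*.
Proof. by rewrite trmx_mul map_mxM. Qed.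

Lemma adjmxD m n (A B : 'M[C]_(m, n)) : (A + B)^t* = A^t* + B^t*.
Proof. by rewrite linearD map_mxD. Qed.

Lemma adjmxN m n (A : 'M[C]_(m, n)) : (- A)^t* = - A^t*.
Proof. by rewrite linearN map_mxN. Qed.

Lemma adjmx1 n : (1%:M : 'M[C]_n)^t* = 1%:M.
Proof. by rewrite trmx1 map_mx1. Qed.

Lemma trace_adjmx n (A : 'M[C]_n) : \tr (A^t*) = (\tr A)^*.
Proof. by rewrite /mxtrace rmorph_sum; apply: eq_bigr => i _; rewrite !mxE. Qed.

Lemma trace_mulmx_adj m n (L : 'M[C]_(m, n)) :
  \tr (L *m L^t*) = \sum_i \sum_j `|L i j| ^+ 2.
Proof.
apply: eq_bigr => i _; rewrite mxE; apply: eq_bigr => j _.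
by rewrite !mxE normCK.
Qed.

Lemma trace_mulmx_adj_ge0 m n (L : 'M[C]_(m, n)) : 0 <= \tr (L *m L^t*).
Proof.
by rewrite trace_mulmx_adj; do 2!(apply: sumr_ge0 => ? _); rewrite exprn_ge0.
Qed.

(** The trace of the Gram matrix is a sum of squared moduli. Below, matrix identities are proved by
    applying this to a difference. *)
Lemma mulmx_adj_eq0 m n (L : 'M[C]_(m, n)) : L^t* *m L = 0 -> L = 0.
Proof.
move=> /(congr1 (fun Z => \tr Z)); rewrite mxtrace0 mxtrace_mulC trace_mulmx_adj.
have ge0 (a : C) : 0 <= `|a| ^+ 2 by rewrite exprn_ge0.
move=> /eqP; rewrite psumr_eq0; last by move=> i _; apply: sumr_ge0.
move=> /allP L0; apply/matrixP => i j; rewrite mxE.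
have /eqP := L0 i (mem_index_enum _).
move=> /eqP; rewrite psumr_eq0 // => /allP/(_ j (mem_index_enum _)).
by rewrite expf_eq0 normr_eq0 => /eqP.
Qed.

Lemma psd_form n (A : 'M[C]_n) : psd (fun i j => A i j) ->
  forall v : 'cV[C]_n, 0 <= (v^t* *m A *m v) 0 0.
Proof.
move=> psdA v; have := psdA (fun i => v i 0).
congr (0 <= _); rewrite mxE exchange_big /=; apply: eq_bigr => j _.
by rewrite mxE mulr_suml; apply: eq_bigr => i _; rewrite !mxE.
Qed.

(* Polarization with the vectors e_i + e_j and e_i + i e_j. *)
Lemma psd_hermitian n (A : 'M[C]_n) : psd (fun i j => A i j) -> A^t* = A.
Proof.
move=> psdA.
pose B (u v : 'cV[C]_n) := (u^t* *m A *m v) 0 0.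
have Brow (u v w : 'cV_n) (a : C) : B u (v + a *: w) = B u v + a * B u w.
  by rewrite /B mulmxDr -scalemxAr !mxE.
have Bcol (u v w : 'cV_n) (a : C) : B (v + a *: w) u = B v u + a^* * B w u.
  by rewrite /B linearD linearZ /= map_mxD map_mxZ !mulmxDl -!scalemxAl !mxE.
have Breal u : (B u u)^* = B u u by apply/CrealP/ger0_real/psd_form.
have BE i j : B (delta_mx i 0) (delta_mx j 0) = A i j.
  by rewrite /B trmx_delta map_delta_mx -mulmxA -rowE -colE !mxE.
apply/matrixP => i j; rewrite !mxE -!BE.
set u := delta_mx i 0; set v := delta_mx j 0.
have h1 := Breal (u + 1 *: v); have h2 := Breal (u + 'i *: v).
have hu := Breal u; have hv := Breal v.
move: h1 h2.
have conjD (p q : C) : (p + q)^* = p^* + q^* := rmorphD _ _ _.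
have conjM (p q : C) : (p * q)^* = p^* * q^* := rmorphM _ _ _.
have conj1 : (1 : C)^* = 1 := rmorph1 _.
rewrite !(Brow, Bcol) !(conjD, conjM, conjCK) hu hv conjCi conj1.
set x := B u v; set y := B v u; set a := B u u; set b := B v v => h1 h2.
have {}h1 : x^* + y^* - x - y = 0 by move/eqP: h1; rewrite -subr_eq0 => /eqP <-; ring.
have {}h2 : y^* - x^* - x + y = 0.
  apply: (mulfI (neq0Ci C)); rewrite mulr0.
  by move/eqP: h2; rewrite -subr_eq0 => /eqP <-; ring.
apply/eqP; rewrite -subr_eq0 -(mulrI_eq0 _ (@mulfI _ 2%:R _)) ?pnatr_eq0 //.
by rewrite -[0]addr0 -{1}h1 -h2; apply/eqP; ring.
Qed.

Lemma psd_gram (I E : finType) (L : I -> E -> C) :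
  psd (fun i j => \sum_e L i e * (L j e)^*).
Proof.
move=> v.
have -> : \sum_i \sum_j (v i)^* * (\sum_e L i e * (L j e)^*) * v j
        = \sum_e `|\sum_j (L j e)^* * v j| ^+ 2.
  transitivity (\sum_i \sum_j \sum_e ((v i)^* * L i e) * ((L j e)^* * v j)).
    apply: eq_bigr => i _; apply: eq_bigr => j _.
    rewrite mulr_sumr mulr_suml; apply: eq_bigr => k _.
    by rewrite !mulrA.
  rewrite (eq_bigr _ (fun i _ => exchange_big _ _ _ _ _ _)) exchange_big /=.
  apply: eq_bigr => k _; rewrite normCKC rmorph_sum mulr_suml.
  apply: eq_bigr => i _; rewrite mulr_sumr; apply: eq_bigr => j _.
  by rewrite rmorphM /= conjCK [(v i)^* * _]mulrC.
by apply: sumr_ge0 => k _; rewrite exprn_ge0.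
Qed.

Lemma psd_gram_mx m n (L : 'M[C]_(m, n)) : psd (fun i j => (L *m L^t*) i j).
Proof.
move=> v; have := psd_gram (fun i j => L i j) v; congr (0 <= _).
apply: eq_bigr => i _; apply: eq_bigr => j _; congr (_ * _ * _).
by rewrite mxE; apply: eq_bigr => k _; rewrite !mxE.
Qed.

(* R is the Moore-Penrose inverse of the square root S. *)
Lemma psd_sqrt_pinv n (A : 'M[C]_n) : psd (fun i j => A i j) ->
  exists S R T : 'M[C]_n,
    [/\ S *m S = A, S = T *m T^t*, R^t* = R, R *m S = S *m R & S *m R *m S = S].
Proof.
move=> psdA.
have hA : A \is hermsymmx.
  by apply/is_hermitianmxP; rewrite expr0 scale1r psd_hermitian.
have UU := spectral_unitarymx A; have dE := orthomx_spectralP (hermitian_normalmx hA).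
have dr := hermitian_spectral_diag_real hA.
move: UU dE dr; set U := spectralmx A; set d := spectral_diag A => UU.
rewrite invmx_unitary // => dE dr.
have UUt : U *m U^t* = 1%:M by apply/unitarymxP.
have d_ge0 i : 0 <= d 0 i.
  have := psd_form psdA (U^t* *m delta_mx i 0).
  rewrite adjmxM trmxCK dE !mulmxA -[_ *m U *m U^t*]mulmxA UUt mulmx1.
  rewrite -[_ *m U *m U^t*]mulmxA UUt mulmx1 trmx_delta map_delta_mx.
  by rewrite -mulmxA -rowE -colE !mxE eqxx mulr1n.
(* Functional calculus: [D f] is f(A). By [d_ge0], only the values of [f] on nonnegative numbers
   matter. *)
pose D (f : C -> C) := U^t* *m diag_mx (map_mx f d) *m U.
have DM f g : D f *m D g = D (fun x => f x * g x).
  rewrite /D -!mulmxA [U *m _]mulmxA UUt mul1mx [diag_mx _ *m _]mulmxA mulmx_diag.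
  congr (_ *m (diag_mx _ *m _)); by apply/rowP => i; rewrite !mxE.
have Dext f g : (forall x, 0 <= x -> f x = g x) -> D f = D g.
  move=> fg; congr (_ *m diag_mx _ *m _); by apply/rowP => i; rewrite !mxE fg.
have Dadj f : (forall x, 0 <= x -> 0 <= f x) -> (D f)^t* = D f.
  move=> f0; rewrite /D !adjmxM trmxCK mulmxA tr_diag_mx map_diag_mx.
  congr (_ *m diag_mx _ *m _); apply/rowP => i; rewrite !mxE.
  by apply/CrealP/ger0_real/f0.
(* At a zero eigenvalue the convention [0^-1 = 0] gives exactly the pseudo-inverse. *)
have sV (x : C) : 0 <= x -> sqrtC x * (sqrtC x)^-1 * sqrtC x = sqrtC x.
  move=> x0; have [->|n0] := eqVneq (sqrtC x) 0; first by rewrite !mulr0.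
  by rewrite divff // mul1r.
(* The fourth root of [A] serves as [T]: it exhibits [S] as a Gram matrix, hence as Hermitian and
   positive semidefinite. *)
exists (D sqrtC), (D (fun x => (sqrtC x)^-1)), (D (fun x => sqrtC (sqrtC x))).
split.
- rewrite DM dE (Dext _ id); last by move=> x _; rewrite -expr2 sqrtCK.
  by congr (_ *m diag_mx _ *m _); apply/rowP => i; rewrite mxE.
- rewrite Dadj; last by move=> x; rewrite !sqrtC_ge0.
  by rewrite DM; apply: Dext => x _; rewrite -expr2 sqrtCK.
- by apply: Dadj => x; rewrite invr_ge0 sqrtC_ge0.
- by rewrite !DM; apply: Dext => x _; rewrite mulrC.
- by rewrite !DM; apply: Dext => x /sV.
Qed.

Lemma psd_gram_ex n (A : 'M[C]_n) : psd (fun i j => A i j) ->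
  exists L : 'M[C]_n, A = L *m L^t*.
Proof.
move=> /psd_sqrt_pinv[S [_ [T [<- dS _ _ _]]]]; exists S.
by rewrite {4}dS adjmxM trmxCK -dS.
Qed.

(** With [R] the pseudo-inverse of [S = |W|], take [G = W R] and let [P = 1 - S R] be the projector
    onto the kernel of [S]. [G] is only a partial isometry; stacking [P] below it gives an
    isometry. *)
Lemma polar_decomposition_mx m n (W : 'M[C]_(m, n)) :
  exists (G : 'M[C]_(m, n)) (S T P : 'M[C]_n),
    [/\ W = G *m S, S = T *m T^t*, P *m S = 0, S *m S = W^t* *m W
      & G^t* *m G + P^t* *m P = 1%:M].
Proof.
have [|S [R [T [SS ST Rh RS SRS]]]] := @psd_sqrt_pinv _ (W^t* *m W).
  by rewrite -{2}[W]trmxCK; apply: psd_gram_mx.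
have Sh : S^t* = S by rewrite {1}ST adjmxM trmxCK -ST.
exists (W *m R), S, T, (1%:M - S *m R).
have Ph : (1%:M - S *m R)^t* = 1%:M - S *m R.
  by rewrite adjmxD adjmxN adjmx1 adjmxM Sh Rh RS.
have PS : (1%:M - S *m R) *m S = 0 by rewrite mulmxBl mul1mx SRS subrr.
split=> //.
  apply/eqP; rewrite -subr_eq0; apply/eqP/mulmx_adj_eq0.
  have -> : W - W *m R *m S = W *m (1%:M - S *m R).
    by rewrite mulmxBr mulmx1 -mulmxA RS.
  by rewrite adjmxM Ph -!mulmxA [W^t* *m _]mulmxA -SS !mulmxA PS !mul0mx.
have PP : (1%:M - S *m R) *m (1%:M - S *m R) = 1%:M - S *m R.
  by rewrite mulmxBr mulmx1 mulmxA PS mul0mx subr0.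
rewrite Ph PP adjmxM Rh -!mulmxA.
by rewrite [W^t* *m _]mulmxA -SS !mulmxA RS SRS addrC subrK.
Qed.

(** Here [Q] is [|X|] and [S] is its square root. The factorization [X = (X R) S] splits [|X|]
    evenly, since the Gram matrix of [X R] is again [S S = Q]. *)
Lemma sqrt_balanced_factors n (X Q : 'M[C]_n) :
  psd (fun i j => Q i j) -> Q *m Q = X^t* *m X ->
  exists L M : 'M[C]_n,
    [/\ X = L *m M^t*, \tr (L *m L^t*) = \tr Q & \tr (M *m M^t*) = \tr Q].
Proof.
move=> /psd_sqrt_pinv[S [R [T [SS ST Rh RS SRS]]]] QX.
have Sh : S^t* = S by rewrite {1}ST adjmxM trmxCK -ST.
exists (X *m R), S; rewrite Sh SS; split=> //.
  apply/eqP; rewrite -subr_eq0; apply/eqP/mulmx_adj_eq0.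
  have -> : X - X *m R *m S = X *m (1%:M - S *m R).
    by rewrite mulmxBr mulmx1 -mulmxA RS.
  have S0 : S *m (1%:M - S *m R) = 0.
    by rewrite mulmxBr mulmx1 -RS mulmxA SRS subrr.
  by rewrite adjmxM -!mulmxA [X^t* *m _]mulmxA -QX -SS -!mulmxA S0 !mulmx0.
rewrite mxtrace_mulC adjmxM Rh -mulmxA [X^t* *m _]mulmxA -QX -SS.
by rewrite !mulmxA RS SRS -!mulmxA -RS [S *m (R *m S)]mulmxA SRS.
Qed.

(** [G] is a contraction with defect [P]. For [E = 1 - G G^*] and [F = G P^*] one computes
    [E = E E + F F^*], which is positive, so [G^*] is a contraction too. *)
Lemma contraction_adj_le n m p (G : 'M[C]_(m, n)) (P : 'M[C]_n) (L : 'M[C]_(m, p)) :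
  G^t* *m G + P^t* *m P = 1%:M ->
  \tr ((G^t* *m L) *m (G^t* *m L)^t*) <= \tr (L *m L^t*).
Proof.
move=> GP; have GG : G^t* *m G = 1%:M - P^t* *m P by rewrite -GP addrK.
pose E := 1%:M - G *m G^t*; pose F := G *m P^t*.
have Eh : E^t* = E by rewrite adjmxD adjmxN adjmx1 adjmxM trmxCK.
have EE : E *m E = E - F *m F^t*.
  have NN : (G *m G^t*) *m (G *m G^t*) = G *m G^t* - F *m F^t*.
    by rewrite -mulmxA [G^t* *m _]mulmxA GG mulmxBl mul1mx mulmxBr !adjmxM trmxCK !mulmxA.
  by rewrite {1}/E mulmxBl mul1mx [(_ *m _) *m E]mulmxBr mulmx1 NN subKr.
rewrite -subr_ge0.
have -> : \tr (L *m L^t*) - \tr ((G^t* *m L) *m (G^t* *m L)^t*)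
   = \tr ((E *m L) *m (E *m L)^t*) + \tr ((F^t* *m L) *m (F^t* *m L)^t*).
  have trE q (K : 'M[C]_(q, m)) :
      \tr ((K *m L) *m (K *m L)^t*) = \tr (L^t* *m (K^t* *m K) *m L).
    by rewrite mxtrace_mulC adjmxM !mulmxA.
  have -> : \tr (L *m L^t*) = \tr (L^t* *m 1%:M *m L).
    by rewrite mulmx1 mxtrace_mulC.
  rewrite !trE !trmxCK Eh EE -linearB -linearD /=.
  by rewrite -mulmxBl -mulmxBr -mulmxDl -mulmxDr subrK.
by rewrite addr_ge0 ?trace_mulmx_adj_ge0.
Qed.

(** The polar decomposition [X = G S] gives [S = G^* X = (G^* L) M^*]. Expanding the squared norm of
    [G^* L - M], which is nonnegative, bounds [2 * \tr S], and [G^*] contracts [L]. *)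
Lemma factors_sqrt_trace_le n m (X : 'M[C]_n) (L M : 'M[C]_(n, m)) :
  X = L *m M^t* -> exists S T : 'M[C]_n,
  [/\ S = T *m T^t*, S *m S = X^t* *m X &
      2 * \tr S <= \tr (L *m L^t*) + \tr (M *m M^t*)].
Proof.
move=> XE; have [G [S [T [P [XGS ST PS SS GP]]]]] := polar_decomposition_mx X.
have Sh : S^t* = S by rewrite {1}ST adjmxM trmxCK -ST.
exists S, T; split=> //.
have GX : G^t* *m X = S.
  by rewrite XGS mulmxA -[_ *m G](addrK (P^t* *m P)) GP mulmxBl mul1mx -mulmxA PS mulmx0 subr0.
have := trace_mulmx_adj_ge0 (G^t* *m L - M).
have -> : \tr ((G^t* *m L - M) *m (G^t* *m L - M)^t*) =
    \tr ((G^t* *m L) *m (G^t* *m L)^t*) + \tr (M *m M^t*) - 2 * \tr S.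
  have h1 : \tr ((G^t* *m L) *m M^t*) = \tr S by rewrite -mulmxA -XE GX.
  have h2 : \tr (M *m (G^t* *m L)^t*) = \tr S.
    have -> : M *m (G^t* *m L)^t* = ((G^t* *m L) *m M^t*)^t*.
      by rewrite [RHS]adjmxM trmxCK.
    by rewrite trace_adjmx h1 -trace_adjmx Sh.
  rewrite [(_ - M)^t*]adjmxD adjmxN mulmxDl !mulmxDr !mulmxN !mulNmx opprK.
  by rewrite !linearD !linearN /= h1 h2; ring.
rewrite subr_ge0 => /le_trans; apply; rewrite lerD2r.
exact: contraction_adj_le GP.
Qed.
End Matrices.

(** * Operators, Hilbert-Schmidt norm and trace norm *)

Lemma fun2_ext (T I V : Type) (f g : T -> I -> V) :
  (forall t i, f t i = g t i) -> f = g.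
Proof. by move=> fg; do 2!(apply: functional_extensionality => ?). Qed.

Section Transport.
Variable C : numClosedFieldType.

Lemma sum_enum_rank (I : finType) (F : 'I_#|I| -> C) :
  \sum_k F k = \sum_(i : I) F (enum_rank i).
Proof. by apply: reindex; apply: onW_bij; exact: enum_rank_bij. Qed.

(** Operators are functions on finite types, while the spectral theorem concerns matrices over
    ordinals; [enum_val] and [enum_rank] pass between the two. *)
Definition mxo (T I : finType) (X : T -> I -> C) : 'M[C]_(#|T|, #|I|) :=
  \matrix_(t, i) X (enum_val t) (enum_val i).

Lemma mxoE (T I : finType) (X : T -> I -> C) t i :
  mxo X (enum_rank t) (enum_rank i) = X t i.
Proof. by rewrite mxE !enum_rankK. Qed.

Lemma mulmx_rank (T I J : finType) (A : 'M[C]_(#|T|, #|I|)) (B : 'M[C]_(#|I|, #|J|)) t j :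
  (A *m B) (enum_rank t) (enum_rank j) =
  \sum_i A (enum_rank t) (enum_rank i) * B (enum_rank i) (enum_rank j).
Proof. by rewrite mxE sum_enum_rank. Qed.

Lemma mulmx_adj_rank (T I J : finType) (A : 'M[C]_(#|T|, #|I|)) (B : 'M[C]_(#|J|, #|I|)) t j :
  (A *m B^t*) (enum_rank t) (enum_rank j) =
  \sum_i A (enum_rank t) (enum_rank i) * (B (enum_rank j) (enum_rank i))^*.
Proof. by rewrite mulmx_rank; apply: eq_bigr => i _; rewrite !mxE. Qed.

Lemma mxo_inj (T I : finType) (A B : 'M[C]_(#|T|, #|I|)) :
  (forall t i, A (enum_rank t) (enum_rank i) = B (enum_rank t) (enum_rank i)) -> A = B.
Proof.
by move=> AB; apply/matrixP => i j; rewrite -(enum_valK i) -(enum_valK j).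
Qed.

Lemma psd_mxo (I : finType) (X : Op C I) : psd X -> psd (fun i j => mxo X i j).
Proof.
move=> psdX v; have := psdX (fun i => v (enum_rank i)); congr (0 <= _).
rewrite sum_enum_rank; apply: eq_bigr => i _.
by rewrite sum_enum_rank; apply: eq_bigr => j _; rewrite mxoE.
Qed.

Lemma mtr_mxo (I : finType) (X : Op C I) : \tr (mxo X) = mtr X.
Proof. by rewrite /mxtrace sum_enum_rank; apply: eq_bigr => i _; rewrite mxoE. Qed.

Definition hs2 (T I : finType) (L : T -> I -> C) : C := \sum_t \sum_i `|L t i| ^+ 2.

Lemma hs2_ge0 (T I : finType) (L : T -> I -> C) : 0 <= hs2 L.
Proof. by do 2!(apply: sumr_ge0 => ? _); rewrite exprn_ge0. Qed.

Lemma hs2_rank (T I : finType) (L : 'M[C]_(#|T|, #|I|)) :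
  hs2 (fun t i => L (enum_rank t) (enum_rank i)) = \tr (L *m L^t*).
Proof.
rewrite trace_mulmx_adj sum_enum_rank; apply: eq_bigr => t _.
by rewrite sum_enum_rank.
Qed.

Lemma hs2_mxo (T I : finType) (L : T -> I -> C) :
  \tr (mxo L *m (mxo L)^t*) = hs2 L.
Proof.
rewrite -hs2_rank; apply: eq_bigr => t _; apply: eq_bigr => i _.
by rewrite mxoE.
Qed.

Lemma hs2_trC (T I : finType) (L : T -> I -> C) : hs2 L = hs2 (fun i t => L t i).
Proof. exact: exchange_big. Qed.

(** The product [L M^*]. Its inner index type is arbitrary, so that it can absorb Kraus indices. *)
Definition opmul (I E J : finType) (L : I -> E -> C) (M : J -> E -> C) : I -> J -> C :=
  fun i j => \sum_e L i e * (M j e)^*.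

Lemma mtr_opmul (I E : finType) (L : I -> E -> C) : mtr (opmul L L) = hs2 L.
Proof. by apply: eq_bigr => i _; apply: eq_bigr => e _; rewrite normCK. Qed.

Lemma psd_gramP (I : finType) (X : Op C I) : psd X ->
  exists L : I -> I -> C, X = opmul L L.
Proof.
move=> /psd_mxo/psd_gram_ex[L XL].
exists (fun i j => L (enum_rank i) (enum_rank j)); apply: fun2_ext => ? ?.
by rewrite -mxoE XL mulmx_adj_rank.
Qed.

(* X has trace norm at most c iff it factors as L M^* with
   (|L|_2^2 + |M|_2^2) / 2 <= c. *)
Definition factors_le (I : finType) (X : Op C I) (c : C) : Prop :=
  exists (E : finType) (L M : I -> E -> C), X = opmul L M /\ hs2 L + hs2 M <= 2 * c.

(** Forward, the balanced factors come from the square root of [|X|]; backward, the bound is that of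
    [factors_sqrt_trace_le]. *)
Lemma tnorm_leP (I : finType) (X : Op C I) (c : C) :
  tnorm_le X c <-> factors_le X c.
Proof.
split=> [[Q [psdQ [QX Qc]]] | [E [L [M [XLM LMc]]]]].
  have [|L [M [XLM tL tM]]] := @sqrt_balanced_factors _ _ (mxo X) (mxo Q) (psd_mxo psdQ).
    apply: mxo_inj => i j; rewrite !mulmx_rank.
    transitivity (mmul Q Q i j); first by apply: eq_bigr => k _; rewrite !mxoE.
    rewrite QX; apply: eq_bigr => k _; by rewrite !mxE !enum_rankK.
  exists I, (fun i e => L (enum_rank i) (enum_rank e)), (fun i e => M (enum_rank i) (enum_rank e)).
  split; first by apply: fun2_ext => ? ?; rewrite -mxoE XLM mulmx_adj_rank.
  by rewrite !hs2_rank tL tM mtr_mxo mulr_natl mulr2n lerD.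
have [|S [T [ST SS tS]]] := @factors_sqrt_trace_le _ _ _ (mxo X) (mxo L) (mxo M).
  by apply: mxo_inj => i j; rewrite mulmx_adj_rank mxoE XLM; apply: eq_bigr => e _; rewrite !mxoE.
exists (fun i j => S (enum_rank i) (enum_rank j)); split; [|split].
- move=> v.
  have := psd_gram (fun i j => T (enum_rank i) (enum_rank j)) v; congr (0 <= _).
  apply: eq_bigr => i _; apply: eq_bigr => j _; congr (_ * _ * _).
  by rewrite ST mulmx_adj_rank.
- apply: fun2_ext => ? ?; rewrite /mmul -mulmx_rank SS mulmx_rank; apply: eq_bigr => k _.
  by rewrite /madj !mxE !enum_rankK.
rewrite -(ler_pM2l (ltr0Sn C 1)); apply: le_trans LMc.
have -> : mtr (fun i j => S (enum_rank i) (enum_rank j)) = \tr S.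
  by rewrite /mxtrace sum_enum_rank.
by apply: le_trans tS _; rewrite !hs2_mxo.
Qed.

Definition is_isometry (T I : finType) (V : T -> I -> C) : Prop :=
  forall i j, \sum_t (V t i)^* * V t j = (i == j)%:R.

Lemma isometry_norm (T I : finType) (V : T -> I -> C) (v : I -> C) : is_isometry V ->
  \sum_t `|\sum_i V t i * v i| ^+ 2 = \sum_i `|v i| ^+ 2.
Proof.
move=> isoV.
transitivity (\sum_t \sum_i \sum_j (V t i)^* * V t j * ((v i)^* * v j)).
  apply: eq_bigr => t _; rewrite normCKC rmorph_sum mulr_suml.
  apply: eq_bigr => i _; rewrite mulr_sumr; apply: eq_bigr => j _.
  by rewrite rmorphM /=; ring.
rewrite exchange_big; apply: eq_bigr => i _; rewrite exchange_big /=.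
under eq_bigr do rewrite -mulr_suml isoV.
rewrite (bigD1 i) //= eqxx mul1r big1 ?addr0 ?normCKC // => j.
by rewrite eq_sym => /negPf ->; rewrite mul0r.
Qed.

(* Polar decomposition with the contraction completed to an isometry by a
   block that annihilates S. *)
Lemma polar_isometry (T I : finType) (W : T -> I -> C) :
  exists (V : T + I -> I -> C) (S : I -> I -> C),
    is_isometry V /\ forall s i, \sum_k V s k * S k i = if s is inl t then W t i else 0.
Proof.
have [G [S [_ [P [WGS _ PS _ GP]]]]] := polar_decomposition_mx (mxo W).
exists (fun s k => match s with inl t => G (enum_rank t) (enum_rank k)
                         | inr j => P (enum_rank j) (enum_rank k) end).
exists (fun k i => S (enum_rank k) (enum_rank i)); split=> [i j | [t|l] i].
- rewrite big_sumType /=.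
  have /matrixP/(_ (enum_rank i) (enum_rank j)) := GP.
  rewrite !mxE !sum_enum_rank (inj_eq enum_rank_inj) => <-.
  by congr (_ + _); apply: eq_bigr => t _; rewrite !mxE.
- by rewrite -mulmx_rank -WGS mxoE.
by rewrite -mulmx_rank PS mxE.
Qed.

End Transport.

(** * Channels, stabilization and purification *)

Section Maps.
Variable C : numClosedFieldType.

Lemma sum_pair (I J : finType) (f : I * J -> C) :
  \sum_p f p = \sum_i \sum_j f (i, j).
Proof. by rewrite pair_bigA; apply: eq_bigr => -[]. Qed.

Lemma linear_map_sum (I J : finType) (F : LMap C I J) (E : finType)
    (c : E -> C) (X : E -> Op C I) : is_linear_map F ->
  F (fun i j => \sum_e c e * X e i j) = fun i j => \sum_e c e * F (X e) i j.
Proof.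
move=> linF.
have F0 : F (fun _ _ => 0) = fun _ _ => 0.
  have := linF (-1) (fun _ _ => 0) (fun _ _ => 0).
  have -> : (fun i j : I => -1 * 0 + 0 : C) = fun _ _ => 0.
    by apply: fun2_ext => ? ?; rewrite mulr0 addr0.
  by move=> ->; apply: fun2_ext => ? ?; rewrite mulN1r addNr.
(* Passing to an arbitrary list of indices makes induction possible. *)
have gen (s : seq E) : F (fun i j => \sum_(e <- s) c e * X e i j) =
    fun i j => \sum_(e <- s) c e * F (X e) i j.
  elim: s => [|e s IHs].
    have -> : (fun i j => \sum_(e <- [::]) c e * X e i j) = fun _ _ => 0.
      by apply: fun2_ext => ? ?; rewrite big_nil.
    by rewrite F0; apply: fun2_ext => ? ?; rewrite big_nil.
  have -> : (fun i j => \sum_(e0 <- e :: s) c e0 * X e0 i j) =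
      fun i j => c e * X e i j + (\sum_(e0 <- s) c e0 * X e0 i j).
    by apply: fun2_ext => ? ?; rewrite big_cons.
  by rewrite (linF (c e) (X e)) IHs; apply: fun2_ext => ? ?; rewrite big_cons.
exact: gen.
Qed.

(** For bijective [f] this regroups tensor factors; in general it selects, and may repeat, rows and
    columns. It is a pullback: [f] runs against the map on operators. *)
Definition reidx (I J : finType) (f : J -> I) : LMap C I J :=
  fun X p q => X (f p) (f q).

Lemma psd_opmul (I E : finType) (L : I -> E -> C) : psd (opmul L L).
Proof. exact: psd_gram. Qed.

Lemma psd_reidx (I J : finType) (f : J -> I) (X : Op C I) : psd X -> psd (reidx f X).
Proof. by move=> /psd_gramP[L ->]; apply: (psd_opmul (fun j e => L (f j) e)). Qed.

Lemma CP_reidx (I J : finType) (f : J -> I) : is_CP (reidx f).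
Proof.
split=> // R X; exact: (@psd_reidx _ _ (fun p : R * J => (p.1, f p.2))).
Qed.

Lemma TP_reidx (I J : finType) (f : J -> I) : bijective f -> is_TP (reidx f).
Proof. by move=> bf X; rewrite /mtr [RHS](reindex f) //; apply: onW_bij. Qed.

Lemma channel_reidx (I J : finType) (f : J -> I) : bijective f -> is_channel (reidx f).
Proof. by move=> bf; split; [exact: CP_reidx | exact: TP_reidx]. Qed.

Lemma CP_comp (I J K : finType) (F : LMap C I J) (G : LMap C J K) :
  is_CP F -> is_CP G -> is_CP (fun X => G (F X)).
Proof.
move=> [linF cpF] [linG cpG]; split=> [a X Y | R X psdX].
  by rewrite linF linG.
exact: (cpG R (ext F X) (cpF R X psdX)).
Qed.

Lemma channel_comp (I J K : finType) (F : LMap C I J) (G : LMap C J K) :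
  is_channel F -> is_channel G -> is_channel (fun X => G (F X)).
Proof.
move=> [cpF tpF] [cpG tpG]; split; first exact: CP_comp.
by move=> X; rewrite tpG tpF.
Qed.

Lemma CP_ext (R I J : finType) (F : LMap C I J) : is_CP F -> is_CP (@ext C R I J F).
Proof.
move=> [linF cpF]; split=> [a X Y | S X psdX].
  by apply: fun2_ext => p q; rewrite /ext linF.
apply: (@psd_reidx _ _ (fun p : S * (R * J) => ((p.1, p.2.1), p.2.2))
  (@ext C (S * R)%type I J F (reidx (fun u => (u.1.1, (u.1.2, u.2))) X))).
exact/cpF/psd_reidx.
Qed.

Lemma TP_ext (R I J : finType) (F : LMap C I J) : is_TP F -> is_TP (@ext C R I J F).
Proof.
move=> tpF X; rewrite /mtr !sum_pair.
by apply: eq_bigr => r _; apply: tpF (fun i i' => X (r, i) (r, i')).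
Qed.

Lemma channel_ext (R I J : finType) (F : LMap C I J) :
  is_channel F -> is_channel (@ext C R I J F).
Proof. by move=> [cpF tpF]; split; [exact: CP_ext | exact: TP_ext]. Qed.

Lemma state_channel (I J : finType) (F : LMap C I J) (X : Op C I) :
  is_channel F -> is_state X -> is_state (F X).
Proof.
move=> [[_ cpF] tpF] [psdX trX]; split; last by rewrite tpF.
(* A one-dimensional reference turns complete positivity into positivity. *)
have := cpF unit (reidx snd X) (psd_reidx _ psdX).
exact: (@psd_reidx _ _ (fun j => (tt, j))).
Qed.

Definition kraus (E I J : finType) (K : E -> J -> I -> C) : LMap C I J :=
  fun X p q => \sum_(x : E * (I * I))
    K x.1 p x.2.1 * (K x.1 q x.2.2)^* * X x.2.1 x.2.2.

(* X |-> \sum_e (K e (x) 1) X (K' e (x) 1)^* ; not CP unless K = K'. *)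
Definition kraus2 (E I I' J : finType) (K K' : E -> I' -> I -> C) :
    LMap C (I * J)%type (I' * J)%type :=
  fun X p q => \sum_(x : E * (I * I))
    K x.1 p.1 x.2.1 * (K' x.1 q.1 x.2.2)^* * X (x.2.1, p.2) (x.2.2, q.2).

(** Each block of [kraus2 K K' X] is a linear combination of blocks of [X], and [F] acts blockwise.
    Hence operations on the reference may be done before or after [F]. *)
Lemma ext_kraus2 (E I I' J J' : finType) (K K' : E -> I' -> I -> C)
    (F : LMap C J J') (X : Op C (I * J)%type) : is_linear_map F ->
  ext F (kraus2 K K' X) = kraus2 K K' (ext F X).
Proof.
move=> linF; apply: fun2_ext => p q.
rewrite /ext /kraus2.
by rewrite (linear_map_sum (fun x => K x.1 p.1 x.2.1 * (K' x.1 q.1 x.2.2)^*)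
  (fun x i i' => X (x.2.1, i) (x.2.2, i')) linF).
Qed.

(** The Kraus operators multiply the two factors from the left, and the Kraus index joins the inner
    index. *)
Lemma kraus2_opmul (E I I' J N : finType) (K K' : E -> I' -> I -> C)
    (L M : I * J -> N -> C) :
  kraus2 K K' (opmul L M) =
  opmul (fun p (ef : E * N) => \sum_l K ef.1 p.1 l * L (l, p.2) ef.2)
        (fun p (ef : E * N) => \sum_l K' ef.1 p.1 l * M (l, p.2) ef.2).
Proof.
apply: fun2_ext => p q.
rewrite /kraus2 /opmul.
rewrite !sum_pair /=.
apply: eq_bigr => e _.
under eq_bigr do rewrite mulr_sumr.
rewrite exchange_big; apply: eq_bigr => f _.
rewrite sum_pair mulr_suml /=.
apply: eq_bigr => l _; rewrite rmorph_sum mulr_sumr; apply: eq_bigr => l' _.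
by rewrite rmorphM /=; ring.
Qed.

Lemma CP_kraus (E I J : finType) (K : E -> J -> I -> C) : is_CP (kraus K).
Proof.
split=> [a X Y | R X psdX].
  apply: fun2_ext => p q.
  rewrite /kraus mulr_sumr -big_split; apply: eq_bigr => x _ /=; ring.
apply: (@psd_reidx _ _ (fun p : R * J => (p.2, p.1))
  (kraus2 K K (reidx (fun u : I * R => (u.2, u.1)) X))).
have /psd_gramP[L ->] := psd_reidx (fun u : I * R => (u.2, u.1)) psdX.
by rewrite kraus2_opmul; exact: psd_opmul.
Qed.

Lemma TP_kraus (E I J : finType) (K : E -> J -> I -> C) :
  (forall i j, \sum_e \sum_p (K e p i)^* * K e p j = (i == j)%:R) -> is_TP (kraus K).
Proof.
move=> KK X; rewrite /mtr /kraus exchange_big /=.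
rewrite sum_pair exchange_big sum_pair /=.
apply: eq_bigr => i _; rewrite (bigD1 i) //= [X in _ + X]big1 ?addr0 => [|j ji].
  transitivity ((\sum_e \sum_p (K e p i)^* * K e p i) * X i i).
    rewrite mulr_suml; apply: eq_bigr => e _; rewrite mulr_suml.
    by apply: eq_bigr => p _; rewrite [(K e p i)^* * _]mulrC.
  by rewrite KK eqxx mul1r.
transitivity ((\sum_e \sum_p (K e p j)^* * K e p i) * X i j).
  rewrite mulr_suml; apply: eq_bigr => e _; rewrite mulr_suml.
  by apply: eq_bigr => p _; rewrite [(K e p j)^* * _]mulrC.
by rewrite KK (negPf ji) mul0r.
Qed.

Lemma swap_bij (I J : finType) : bijective (fun u : I * J => (u.2, u.1)).
Proof. by exists (fun u : J * I => (u.2, u.1)) => [[]|[]]. Qed.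

(** [kraus2 K K] is the extension of [kraus K] conjugated by swaps of the two tensor factors. *)
Lemma channel_kraus2 (E I I' J : finType) (K : E -> I' -> I -> C) :
  (forall i j, \sum_e \sum_p (K e p i)^* * K e p j = (i == j)%:R) ->
  is_channel (@kraus2 E I I' J K K).
Proof.
move=> KK; have chK : is_channel (@ext C J I I' (kraus K)).
  by apply: channel_ext; split; [exact: CP_kraus | exact: TP_kraus].
have := channel_comp (channel_comp (channel_reidx (swap_bij J I)) chK)
  (channel_reidx (swap_bij I' J)).
by [].
Qed.

(* Complete positivity is applied to the positive block operator with
   off-diagonal block X built from a factorization of X. *)
Lemma factors_le_channel (I J : finType) (F : LMap C I J) (X : Op C I) (c : C) :
  is_channel F -> factors_le X c -> factors_le (F X) c.
Proof.
move=> [[linF cpF] tpF] [E [L [M [XLM LMc]]]].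
have hs2_bool (T N : finType) (W : bool * T -> N -> C) :
    hs2 W = hs2 (fun t e => W (true, t) e) + hs2 (fun t e => W (false, t) e).
  by rewrite /hs2 sum_pair big_bool.
(* [N] stacks [L] on [M]: its Gram operator has [X] as the (true, false) block and trace
   [hs2 L + hs2 M]. *)
pose N (p : bool * I) e := if p.1 then L p.2 e else M p.2 e.
have [N' FN] := psd_gramP (cpF bool _ (psd_opmul N)).
exists (bool * J)%type, (fun j e => N' (true, j) e), (fun j e => N' (false, j) e); split.
  apply: fun2_ext => j j'; have := congr1 (fun f => f (true, j) (false, j')) FN.
  by rewrite /ext /= XLM.
rewrite -hs2_bool -mtr_opmul -FN TP_ext // mtr_opmul hs2_bool.
by apply: le_trans LMc.
Qed.

Lemma hs2_isometry (T I J : finType) (V : T -> I -> C) (S : I -> J -> C) :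
  is_isometry V -> hs2 (fun t j => \sum_i V t i * S i j) = hs2 S.
Proof.
move=> isoV; rewrite hs2_trC [RHS]hs2_trC; apply: eq_bigr => j _.
exact: isometry_norm.
Qed.

(** The isometry preserves the norm of [S], and its extra block contributes only zeros. *)
Lemma hs2_polar (T I : finType) (W : T -> I -> C) (V : T + I -> I -> C) (S : I -> I -> C) :
  is_isometry V ->
  (forall s i, \sum_k V s k * S k i = if s is inl t then W t i else 0) ->
  hs2 S = hs2 W.
Proof.
move=> isoV VS; rewrite -(hs2_isometry S isoV) /hs2 big_sumType /=.
rewrite [X in _ + X]big1 ?addr0 => [|l _].
  by apply: eq_bigr => t _; apply: eq_bigr => i _; rewrite VS.
by rewrite big1 // => i _; rewrite VS normr0 expr0n.
Qed.

Lemma hs2_pair (E K I : finType) (L : K * I -> E -> C) :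
  hs2 (fun (ek : E * K) i => L (ek.2, i) ek.1) = hs2 L.
Proof.
rewrite /hs2 !sum_pair exchange_big.
by apply: eq_bigr => k _; exact: exchange_big.
Qed.

(* |S>><<S'|, where |S>> is the vector with coordinates S. *)
Definition ketbra (I J : finType) (S S' : I -> J -> C) : Op C (I * J)%type :=
  fun p q => S p.1 p.2 * (S' q.1 q.2)^*.

Lemma ketbraE (I J : finType) (S S' : I -> J -> C) :
  ketbra S S' = opmul (fun p (_ : unit) => S p.1 p.2) (fun p (_ : unit) => S' p.1 p.2).
Proof. by apply: fun2_ext => ? ?; rewrite /opmul (big_pred1 tt) //; case. Qed.

Lemma hs2_vec (I J : finType) (S : I -> J -> C) :
  hs2 (fun p (_ : unit) => S p.1 p.2) = hs2 S.
Proof.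
rewrite /hs2 sum_pair; apply: eq_bigr => i _; apply: eq_bigr => j _.
by rewrite (big_pred1 tt) //; case.
Qed.

(** Dropping the [inr] block of an isometry leaves a contraction; the loss is the squared norm of
    the dropped rows. *)
Lemma hs2_contraction (E K I J N : finType) (V : (E * K) + I -> I -> C) (L : I * J -> N -> C) :
  is_isometry V ->
  hs2 (fun p (ef : E * N) => \sum_l V (inl (ef.1, p.1)) l * L (l, p.2) ef.2) <= hs2 L.
Proof.
move=> isoV.
pose W (t : E * K) (jf : J * N) := \sum_l V (inl t) l * L (l, jf.1) jf.2.
have -> : hs2 (fun p (ef : E * N) => \sum_l V (inl (ef.1, p.1)) l * L (l, p.2) ef.2) = hs2 W.
  rewrite /hs2 !sum_pair [RHS]exchange_big; apply: eq_bigr => k _.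
  rewrite /=; under eq_bigr do rewrite sum_pair.
  rewrite exchange_big; apply: eq_bigr => e _.
  by rewrite sum_pair.
have -> : hs2 L = hs2 (fun l (jf : J * N) => L (l, jf.1) jf.2).
  by rewrite /hs2 sum_pair; apply: eq_bigr => l _; rewrite sum_pair.
rewrite -(hs2_isometry (fun l (jf : J * N) => L (l, jf.1) jf.2) isoV) [leRHS]/hs2 big_sumType /=.
rewrite lerDl; exact: (@hs2_ge0 C I (J * N)%type (fun l jf => \sum_i V (inr l) i * L (i, jf.1) jf.2)).
Qed.

(* Z = \sum_e (V_e (x) 1) |S>><<S'| (V'_e (x) 1)^* for contractions V, V', and F acts
   on |S>><<S'| whose reference system is a copy of the input. *)
Lemma factors_le_ext (K I J : finType) (F : LMap C I J) (c : C) (Z : Op C (K * I)%type) :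
  is_linear_map F -> diamond_le F c -> factors_le Z 1 -> factors_le (@ext C K I J F Z) c.
Proof.
move=> linF Fc [E [L [M [ZLM LM]]]].
(* Taking [e] and [k] together as the row index moves the reference [K] into [V] and leaves [S] on
   two copies of the input. *)
have [V [S [isoV VS]]] := polar_isometry (fun (ek : E * K) i => L (ek.2, i) ek.1).
have [V' [S' [isoV' VS']]] := polar_isometry (fun (ek : E * K) i => M (ek.2, i) ek.1).
have hS := hs2_polar isoV VS; have hS' := hs2_polar isoV' VS'.
rewrite hs2_pair in hS; rewrite hs2_pair in hS'.
have /tnorm_leP/Fc/tnorm_leP[N [L1 [M1 [YE LM1]]]] : factors_le (ketbra S S') 1.
  rewrite ketbraE; do 3!eexists; split; first by [].
  by rewrite !hs2_vec hS hS'.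
have -> : Z = kraus2 (fun e k l => V (inl (e, k)) l) (fun e k l => V' (inl (e, k)) l) (ketbra S S').
  rewrite ZLM ketbraE kraus2_opmul.
  apply: fun2_ext => p q.
  rewrite /opmul sum_pair.
  apply: eq_bigr => e _; rewrite (big_pred1 tt) ?VS ?VS' -?surjective_pairing //; by case.
rewrite ext_kraus2 // YE kraus2_opmul; do 3!eexists; split; first by [].
by apply: le_trans LM1; rewrite lerD ?hs2_contraction.
Qed.

(* The reduced state on I is purified to |S>> on I x I; the part of the isometry
   annihilating S is sent to an arbitrary basis vector k0 to preserve the trace. *)
Lemma state_purification (K I : finType) (rho : Op C (K * I)%type) : is_state rho ->
  exists (phi : Op C (I * I)%type) (E : finType) (G : E -> K -> I -> C),
    [/\ is_pure phi, forall i j, \sum_e \sum_p (G e p i)^* * G e p j = (i == j)%:R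
      & rho = kraus2 G G phi].
Proof.
move=> [/psd_gramP[L rhoL] trL].
(* If [K] were empty, the trace of [rho] would be 0 instead of 1. *)
have [k0 _] : exists k0 : K, true.
  case: (pickP (@predT K)) => [k _|K0]; first by exists k.
  move: trL; rewrite /mtr big1 => [/eqP|[k i] _]; last by have := K0 k.
  by rewrite eq_sym oner_eq0.
have [V [S [isoV VS]]] := polar_isometry (fun (ek : (K * I) * K) i => L (ek.2, i) ek.1).
have := hs2_polar isoV VS; rewrite hs2_pair -(mtr_opmul L) -rhoL trL => hS.
exists (ketbra S S), ((K * I) + I)%type, (fun s k l => match s with
   | inl e => V (inl (e, k)) l | inr j => (k == k0)%:R * V (inr j) l end); split.
- exists (fun p => S p.1 p.2); split=> //.
  by rewrite -hS /hs2 sum_pair.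
- move=> i j; rewrite big_sumType /= -isoV big_sumType /=; congr (_ + _).
    by rewrite [RHS]sum_pair.
  apply: eq_bigr => l _; rewrite (bigD1 k0) //= eqxx !mul1r big1 ?addr0 // => k /negPf->.
  by rewrite !mul0r mulr0.
rewrite ketbraE kraus2_opmul rhoL.
apply: fun2_ext => p q.
rewrite /opmul [RHS]sum_pair.
(* The Kraus operators indexed by [inr] contribute nothing, as their block of [V] annihilates
   [S]. *)
rewrite [RHS]big_sumType /= [X in _ + X]big1 ?addr0 => [|l _].
  by apply: eq_bigr => e _; rewrite (big_pred1 tt) ?VS -?surjective_pairing //; case.
rewrite big1 // => _ _; under eq_bigr do rewrite -mulrA.
by rewrite -mulr_sumr VS mulr0 mul0r.
Qed.

End Maps.

(** * Extended reals *)

Lemma xle_trans (x y z : xreal) : xle x y -> xle y z -> xle x z.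
Proof. by case: x y z => [x||] [y||] [z||] //=; exact: RIneq.Rle_trans. Qed.

Lemma xle_pinf (x : xreal) : xle x XPInf.
Proof. by case: x. Qed.

(** Existence is what makes the epsilon in [xsup] meaningful. When +oo is not a member, completeness
    of the reals settles the case of a nonempty bounded finite part; the remaining cases give -oo or
    +oo. *)
Lemma xlub_ex (P : xreal -> Prop) : exists s, is_xlub P s.
Proof.
have [Ppinf | Npinf] := classic (P XPInf).
  by exists XPInf; split=> [x _|u]; [exact: xle_pinf | apply].
have [[a Pa] | Nfin] := classic (exists a, P (XFin a)); last first.
  exists XMInf; split=> [[a||] // Px|u _ //].
  by case: Nfin; exists a.
pose Q a := P (XFin a).
have [bQ | NbQ] := classic (Raxioms.bound Q).
  have [m [ubm lubm]] := Raxioms.completeness Q bQ (ex_intro _ a Pa).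
  exists (XFin m); split=> [[b||] // Pb|[u||] ubu //=].
  - exact: ubm.
  - by apply: lubm => b Qb; apply: (ubu (XFin b)).
  - exact: (ubu (XFin a)).
exists XPInf; split=> [x _|[u||] ubu //]; first exact: xle_pinf.
- by case: NbQ; exists u => b Qb; apply: (ubu (XFin b)).
- exact: (ubu (XFin a)).
Qed.

Lemma xglb_ex (P : xreal -> Prop) : exists s, is_xglb P s.
Proof.
have [s [ubs lubs]] := xlub_ex (fun u => forall x, P x -> xle u x).
by exists s; split=> [x Px|u lbu]; [apply: lubs => u; exact | exact: ubs].
Qed.

Lemma xsupP (P : xreal -> Prop) : is_xlub P (xsup P).
Proof. exact: epsilon_spec (xlub_ex P). Qed.

Lemma xinfP (P : xreal -> Prop) : is_xglb P (xinf P).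
Proof. exact: epsilon_spec (xglb_ex P). Qed.

Lemma xsup_le (P Q : xreal -> Prop) :
  (forall x, P x -> exists2 y, Q y & xle x y) -> xle (xsup P) (xsup Q).
Proof.
move=> PQ; apply: (proj2 (xsupP P)) => x /PQ[y Qy xy].
exact: xle_trans xy (proj1 (xsupP Q) y Qy).
Qed.

Lemma xinf_le (P Q : xreal -> Prop) :
  (forall y, Q y -> exists2 x, P x & xle x y) -> xle (xinf P) (xinf Q).
Proof.
move=> QP; apply: (proj2 (xinfP Q)) => y /QP[x Px xy].
exact: xle_trans (proj1 (xinfP P) x Px) xy.
Qed.

(** * Superchannels *)

Section Superchannels.
Variable C : numClosedFieldType.

Lemma pure_state (I : finType) (psi : Op C I) : is_pure psi -> is_state psi.
Proof.
move=> [v [v1 ->]]; split; last by rewrite -v1; apply: eq_bigr => i _; rewrite normCK.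
move=> w; have := psd_gram (fun i (_ : unit) => v i) w; congr (0 <= _).
apply: eq_bigr => i _; apply: eq_bigr => j _; congr (_ * _ * _).
by rewrite (big_pred1 tt) //; case.
Qed.

Lemma ptBK (Al Bo : finType) : involutive (@ptB C Al Bo).
Proof. by move=> X; apply: fun2_ext => -[? ?] [? ?]. Qed.

Lemma mtr_ptB (Al Bo : finType) (X : Op C (Al * Bo)%type) : mtr (ptB X) = mtr X.
Proof. by apply: eq_bigr => -[]. Qed.

(** The transposed map need not be completely positive; linearity is what [factors_le_ext] asks of
    it. *)
Lemma ptB_linear (A' B' A B : finType) (F : LMap C (A' * B')%type (A * B)%type) :
  is_linear_map F -> is_linear_map (fun X => ptB (F (ptB X))).
Proof.
move=> linF a X Y; apply: fun2_ext => p q.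
by rewrite /ptB (linF a (ptB X) (ptB Y)).
Qed.

Lemma cPPT_ptB_channel (A' B' A B : finType) (P : LMap C (A' * B')%type (A * B)%type) :
  is_cPPT P -> is_channel (fun X => ptB (P (ptB X))).
Proof. by move=> [[_ tpP] cpP]; split=> // X; rewrite mtr_ptB tpP mtr_ptB. Qed.

Section Memory.
Variables (R AM BM : finType).

(** Through [reidx], this hands the memory over to the reference. The name follows the direction on
    operators; on indices the function runs the other way. *)
Definition memory_to_ref (I J : finType) (u : (R * (AM * BM)) * (I * J)) :
    R * ((I * AM) * (J * BM)) :=
  (u.1.1, ((u.2.1, u.1.2.1), (u.2.2, u.1.2.2))).

Definition ref_to_memory (I J : finType) (u : R * ((I * AM) * (J * BM))) :
    (R * (AM * BM)) * (I * J) :=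
  ((u.1, (u.2.1.2, u.2.2.2)), (u.2.1.1, u.2.2.1)).

Lemma memory_to_ref_bij (I J : finType) : bijective (@memory_to_ref I J).
Proof. by exists (@ref_to_memory I J) => [[[? [? ?]] [? ?]]|[? [[? ?] [? ?]]]]. Qed.

Lemma ref_to_memory_bij (I J : finType) : bijective (@ref_to_memory I J).
Proof. by exists (@memory_to_ref I J) => [[? [[? ?] [? ?]]]|[[? [? ?]] [? ?]]]. Qed.

End Memory.

Lemma CP_lift_mem (Ah' Bh' Ah Bh AM BM : finType)
    (M : LMap C (Ah' * Bh')%type (Ah * Bh)%type) :
  is_CP M -> is_CP (@lift_mem C Ah' Bh' Ah Bh AM BM M).
Proof.
move=> cpM; have := CP_comp (CP_comp
  (CP_reidx C (fun u : (AM * BM) * (Ah' * Bh') => ((u.2.1, u.1.1), (u.2.2, u.1.2))))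
  (@CP_ext C (AM * BM)%type _ _ _ cpM))
  (CP_reidx C (fun u : (Ah * AM) * (Bh * BM) => ((u.1.2, u.2.2), (u.1.1, u.2.1)))).
by [].
Qed.

(** The memory passes through an identity map, so the two transposes on [BM] cancel. *)
Lemma ptB_lift_mem (Ah' Bh' Ah Bh AM BM : finType)
    (M : LMap C (Ah' * Bh')%type (Ah * Bh)%type) X :
  ptB (@lift_mem C Ah' Bh' Ah Bh AM BM M (ptB X)) =
  @lift_mem C Ah' Bh' Ah Bh AM BM (fun Y => ptB (M (ptB Y))) X.
Proof. by []. Qed.

Variables (A' B' Ah' Bh' AM BM Ah Bh A B : finType).
Variables (Ppre : LMap C (A' * B')%type ((Ah' * AM) * (Bh' * BM))%type)
  (Ppost : LMap C ((Ah * AM) * (Bh * BM))%type (A * B)%type).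

Lemma CP_superchan (M : LMap C (Ah' * Bh')%type (Ah * Bh)%type) :
  is_CP Ppre -> is_CP Ppost -> is_CP M -> is_CP (superchan Ppre Ppost M).
Proof.
move=> cpre cpost cpM.
exact: CP_comp (CP_comp cpre (@CP_lift_mem _ _ _ _ AM BM _ cpM)) cpost.
Qed.

Lemma ptB_superchan (M : LMap C (Ah' * Bh')%type (Ah * Bh)%type) :
  (fun X => ptB (superchan Ppre Ppost M (ptB X))) =
  superchan (fun X => ptB (Ppre (ptB X))) (fun X => ptB (Ppost (ptB X)))
    (fun X => ptB (M (ptB X))).
Proof.
by apply: functional_extensionality => X; rewrite /superchan -ptB_lift_mem !ptBK.
Qed.

(** Once the memory has joined the reference, [M] faces a reference that need not be a copy of its
    input, hence [factors_le_ext]. Every other stage is a channel and keeps the bound. *)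
Lemma diamond_le_superchan (M : LMap C (Ah' * Bh')%type (Ah * Bh)%type) (c : C) :
  is_channel Ppre -> is_channel Ppost -> is_linear_map M ->
  diamond_le M c -> diamond_le (superchan Ppre Ppost M) c.
Proof.
move=> chpre chpost linM Mc X /tnorm_leP X1; apply/tnorm_leP.
have X2 := factors_le_channel (@channel_ext C (A' * B')%type _ _ _ chpre) X1.
have X3 := factors_le_channel (channel_reidx C (@memory_to_ref_bij _ AM BM Ah' Bh')) X2.
have X4 := factors_le_ext linM Mc X3.
have X5 := factors_le_channel (channel_reidx C (@ref_to_memory_bij _ AM BM Ah Bh)) X4.
exact: factors_le_channel (@channel_ext C (A' * B')%type _ _ _ chpost) X5.
Qed.

Lemma chan_div_superchan (D : forall I : finType, Op C I -> Op C I -> xreal)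
    (N M : LMap C (Ah' * Bh')%type (Ah * Bh)%type) :
  is_gen_divergence D -> is_channel Ppre -> is_channel Ppost ->
  is_channel N -> is_CP M ->
  xle (chan_div D (superchan Ppre Ppost N) (superchan Ppre Ppost M)) (chan_div D N M).
Proof.
move=> dpi chpre chpost chN cpM; apply: xsup_le => _ [psi [ppsi ->]].
pose rho := reidx (@memory_to_ref (A' * B')%type AM BM Ah' Bh') (ext Ppre psi).
have [|phi [E [G [pphi GG rhoG]]]] := @state_purification C _ _ rho.
  apply: state_channel (channel_reidx C (@memory_to_ref_bij _ _ _ _ _)) _.
  exact: state_channel (@channel_ext C (A' * B')%type _ _ _ chpre) (pure_state ppsi).
(* [Xi] gathers everything around the inner map. It depends on [psi] but not on that map, so one
   channel [Xi] and one pure [phi] serve both [N] and [M]. *)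
pose Xi (X : Op C ((Ah' * Bh') * (Ah * Bh))%type) :=
  ext Ppost (reidx (@ref_to_memory (A' * B')%type AM BM Ah Bh) (kraus2 G G X)).
have chXi : is_channel Xi.
  exact: (channel_comp
    (channel_comp (channel_kraus2 (Ah * Bh)%type GG)
      (channel_reidx C (@ref_to_memory_bij (A' * B')%type AM BM Ah Bh)))
    (@channel_ext C (A' * B')%type _ _ _ chpost)).
have XiE (F : LMap C (Ah' * Bh')%type (Ah * Bh)%type) : is_linear_map F ->
    ext (superchan Ppre Ppost F) psi = Xi (ext F phi).
  move=> linF; rewrite /Xi -ext_kraus2 // -rhoG.
  by [].
exists (D _ (ext N phi) (ext M phi)); first by exists phi.
rewrite !XiE; [|exact: (proj1 cpM) | exact: (proj1 (proj1 chN))].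
apply: dpi chXi _ _ _ _; last exact: (proj2 cpM) (proj1 (pure_state pphi)).
exact: state_channel (@channel_ext C (Ah' * Bh')%type _ _ _ chN) (pure_state pphi).
Qed.

End Superchannels.

Theorem mainTheorem5 (C : numClosedFieldType)
  (D : forall I : finType, Op C I -> Op C I -> xreal)
  (A' B' Ah' Bh' AM BM Ah Bh A B : finType)
  (M : LMap C (Ah' * Bh')%type (Ah * Bh)%type)
  (Ppre : LMap C (A' * B')%type ((Ah' * AM) * (Bh' * BM))%type)
  (Ppost : LMap C ((Ah * AM) * (Bh * BM))%type (A * B)%type) :
  is_gen_divergence D ->
  is_channel M ->
  is_cPPT Ppre ->
  is_cPPT Ppost ->
  xle (rains D (superchan Ppre Ppost M)) (rains D M).
Proof.
move=> dpi chM cpre cpost; apply: xinf_le => _ [N [cpN [ENN ->]]].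
have [chpre _] := cpre; have [chpost _] := cpost.
exists (chan_div D (superchan Ppre Ppost M) (superchan Ppre Ppost N)); last first.
  exact: chan_div_superchan.
exists (superchan Ppre Ppost N); split; [|split=> //].
  by apply: CP_superchan => //; [exact: (proj1 chpre) | exact: (proj1 chpost)].
(* The transposes now surround each stage separately; the PPT hypotheses make the outer two stages
   channels, and [ENN] bounds the inner one. *)
rewrite /EN_le0 ptB_superchan; apply: diamond_le_superchan ENN.
- exact: cPPT_ptB_channel.
- exact: cPPT_ptB_channel.
exact/ptB_linear/(proj1 cpN).
Qed.
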